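(* Let $a<b$ be real numbers and let $f:[a,b]\to\mathbb{R}^{+}$ be multiplicatively differentiable on $[a,b]$. If $f^{\ast}$ is multiplicatively integrable on $[a,b]$, then $$G\left(f(a),f(b)\right)\left(\int_{a}^{b} f(u)^{du}\right)^{\frac{1}{a-b}}=\left(\int_{0}^{1}\left(f^{\ast}\left((1-t)a+tb\right)^{(2t-1)}\right)^{dt}\right)^{\frac{b-a}{2}},$$ where $G$ is the geometric mean, i.e. $G(\alpha,\beta)=\sqrt{\alpha\beta}$ for $\alpha,\beta>0$.
   Context: $\mathbb{R}^{+}$ denotes the positive real numbers. For a positive function $f$, the multiplicative derivative at $t$ is $f^{\ast}(t)=\lim_{h\to 0}\left(\frac{f(t+h)}{f(t)}\right)^{1/h}$ (one-sided limits at endpoints of the interval); $f$ is multiplicatively differentiable on $[a,b]$ if this limit exists as a positive real number at every $t\in[a,b]$. If $f$ is positive and differentiable at $t$, then $f^{\ast}(t)=e^{(\ln f(t))'}=e^{f'(t)/f(t)}$. The multiplicative integral of a positive function $g$ on $[c,d]$ is $\int_{c}^{d} (g(t))^{dt}=\exp\left(\int_{c}^{d}\ln g(t)\,dt\right)$, where the right-hand integral is a Riemann integral; $g$ is multiplicatively integrable on $[c,d]$ if $\ln g$ is Riemann integrable there. An expression $f^{\ast}(x)^{s}$ means $(f^{\ast}(x))^{s}$. *)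

(* Defs.v *)
From Stdlib Require Export Reals.
From Coquelicot Require Export Coquelicot.

Local Open Scope R_scope.

(* [is_mul_derive a b f t l] : the multiplicative derivative at [t] of [f],
   viewed as a function on [[a,b]], exists and is the positive real [l].
   The increment [h] tends to 0 through nonzero values with [t + h] in [[a,b]]:
   this is the two-sided limit for [a < t < b], the limit from the right at
   [t = a], the limit from the left at [t = b], and it never looks at [f]
   outside [[a,b]]. *)
Definition is_mul_derive (a b : R) (f : R -> R) (t l : R) : Prop :=
  0 < l /\
  filterlim (fun h => Rpower (f (t + h) / f t) (1 / h))
    (within (fun h => a <= t + h <= b) (locally' 0))
    (locally l).

Definition ex_mul_derive (a b : R) (f : R -> R) (t : R) : Prop :=
  exists l : R, is_mul_derive a b f t l.

Definition mul_derive (a b : R) (f : R -> R) (t : R) : R :=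
  iota (is_mul_derive a b f t).

Definition positive_on (c d : R) (g : R -> R) : Prop :=
  forall t : R, c <= t <= d -> 0 < g t.

Definition mul_differentiable_on (a b : R) (f : R -> R) : Prop :=
  forall t : R, a <= t <= b -> ex_mul_derive a b f t.

(* Positivity is required because [ln] is total, with value 0 at nonpositive
   arguments. *)
Definition mul_integrable (g : R -> R) (c d : R) : Prop :=
  positive_on c d g /\ ex_RInt (fun t => ln (g t)) c d.

Definition mul_integral (g : R -> R) (c d : R) : R :=
  exp (RInt (fun t => ln (g t)) c d).

Definition geom_mean (x y : R) : R := sqrt (x * y).

(* Main.v *)
Require Import Defs.
From Stdlib Require Import Reals Lra Lia.
From Coquelicot Require Import Coquelicot.
Local Open Scope R_scope.

(** Put [F = ln f] and [g = ln f*].  Taking logarithms of the multiplicative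
    difference quotient turns it into the ordinary one, so [F] has derivative
    [g] at every point of [[a,b]] (one-sided at the endpoints), and the theorem
    becomes the exponential of the trapezoid identity

      [(F a + F b) / 2 - (1 / (b - a)) * int_a^b F
         = ((b - a) / 2) * int_0^1 (2 t - 1) g ((1 - t) a + t b) dt].

    With [m = (a + b) / 2], the substitution [x = (1 - t) a + t b] turns the
    right-hand side into [(1 / (b - a)) * int_a^b (x - m) g x dx], and the
    identity is integration by parts: the derivative of [(x - m) F x] is
    [F x + (x - m) g x].

    The difficulty is that [g] is merely Riemann integrable, possibly
    discontinuous, so the usual theorems with a continuous derivative do not
    apply.  Two facts replace them.  The fundamental theorem of calculus holds
    for any Riemann integrable derivative ([RInt_of_derivative]): choosing the
    tags by the mean value theorem makes Riemann sums telescope.  And the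
    product of a continuous function with an integrable one is integrable
    ([ex_RInt_mult_continuous]): freezing the continuous factor on short
    intervals approximates the product uniformly.  The one-sided derivatives
    at the endpoints are dealt with by extending [F] as a constant outside
    [[a,b]]: the extension is continuous at the endpoints, which is all that the
    fundamental theorem asks for there. *)

(** * The fundamental theorem for integrable derivatives *)

Lemma subdivide_lt (d delta : R) (hd : 0 < d) (hdelta : 0 < delta) :
  exists (n : nat) (s : R), 0 < s < delta /\ INR n * s = d.
Proof.
  destruct (nfloor_ex (d / delta)) as [n [_ hn]].
  { apply Rlt_le, Rdiv_lt_0_compat; assumption. }
  assert (hn0 : 0 < INR n + 1) by (generalize (pos_INR n); lra).
  exists (S n), (d / (INR n + 1)). rewrite S_INR.
  split; [split|].
  - apply Rdiv_lt_0_compat; assumption.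
  - apply Rlt_div_l; [assumption|].
    apply Rlt_div_l in hn; lra.
  - field; lra.
Qed.

(** On each piece [[x, x + s]] the mean value theorem provides a tag [c] with
    [h c * s = H (x + s) - H x], so the Riemann sum of [h] telescopes.  Building
    the partition by recursion on the number of pieces avoids choosing tags for
    all intervals at once. *)
Lemma tagged_partition_by_MVT (H h : R -> R) (a b : R)
  (H_cont : forall x, a <= x <= b -> continuity_pt H x)
  (H_diff : forall x, a < x < b -> is_derive H x (h x))
  (s : R) (hs : 0 < s) (n : nat) :
  forall x, a <= x -> x + INR n * s <= b ->
  exists P : SF_seq,
    pointed_subdiv P /\ SF_h P = x /\
    seq.last (SF_h P) (SF_lx P) = x + INR n * s /\
    seq_step (SF_lx P) <= s /\
    Riemann_sum h P = H (x + INR n * s) - H x.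
Proof.
  induction n as [|n IH]; intros x hax hxb.
  - simpl INR in *. rewrite Rmult_0_l, Rplus_0_r in *.
    exists (SF_nil x). repeat split.
    + unfold SF_size in *; simpl in *; lia.
    + unfold SF_size in *; simpl in *; lia.
    + unfold seq_step; simpl; lra.
    + unfold Riemann_sum; simpl. unfold zero; simpl. ring.
  - rewrite S_INR in *.
    assert (hns : 0 <= INR n * s).
    { apply Rmult_le_pos; [apply pos_INR|lra]. }
    assert (e : x + (INR n + 1) * s = x + s + INR n * s) by ring.
    rewrite e in *.
    destruct (IH (x + s)) as [P [hP [hh [hl [hst hsum]]]]]; [lra|lra|].
    destruct (MVT_gen H x (x + s) h) as [c [hc hHc]].
    { rewrite Rmin_left, Rmax_right by lra. intros y hy. apply H_diff; lra. }
    { rewrite Rmin_left, Rmax_right by lra. intros y hy. apply H_cont; lra. }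
    rewrite Rmin_left, Rmax_right in hc by lra.
    exists (SF_cons (x, c) P).
    repeat split.
    + destruct i as [|i].
      * simpl. lra.
      * apply hP. rewrite SF_size_cons in *. lia.
    + destruct i as [|i].
      * simpl. rewrite hh. lra.
      * apply hP. rewrite SF_size_cons in *. lia.
    + rewrite <- hl. reflexivity.
    + change (Rmax (Rabs (SF_h P - x)) (seq_step (SF_lx P)) <= s).
      apply Rmax_lub; [|assumption].
      rewrite hh, Rabs_pos_eq; lra.
    + rewrite Riemann_sum_cons, hsum, hh. simpl.
      unfold plus, scal; simpl; unfold mult; simpl.
      replace (x + s - x) with s in * by ring.
      lra.
Qed.

(** Arbitrarily fine Riemann sums of [h] equal [H b - H a] exactly, and since
    [h] is integrable all fine enough Riemann sums are close to its integral. *)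
Lemma RInt_of_derivative (H h : R -> R) (a b : R) (hab : a < b)
  (H_cont : forall x, a <= x <= b -> continuity_pt H x)
  (H_diff : forall x, a < x < b -> is_derive H x (h x))
  (h_int : ex_RInt h a b) :
  RInt h a b = H b - H a.
Proof.
  pose proof (RInt_correct h a b h_int) as hI.
  destruct (Req_dec (RInt h a b) (H b - H a)) as [|hne]; [assumption|exfalso].
  assert (heps : 0 < Rabs (RInt h a b - (H b - H a))) by (apply Rabs_pos_lt; lra).
  unfold is_RInt in hI.
  pose proof (proj1 (filterlim_locally _ _) hI) as hI'. clear hI.
  destruct (hI' (mkposreal _ heps)) as [delta hdelta].
  destruct (subdivide_lt (b - a) delta) as [n [s [hs hns]]];
    [lra|apply cond_pos|].
  destruct (tagged_partition_by_MVT H h a b H_cont H_diff s (proj1 hs) n a)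
    as [P [hP [hh [hl [hst hsum]]]]]; [lra|lra|].
  rewrite hns in *. replace (a + (b - a)) with b in * by ring.
  specialize (hdelta P). simpl in hdelta.
  rewrite Rmin_left, Rmax_right in hdelta by lra.
  rewrite sign_eq_1 in hdelta by lra.
  assert (hb : Rabs (scal 1 (Riemann_sum h P) - RInt h a b) <
               Rabs (RInt h a b - (H b - H a))).
  { apply hdelta; [|repeat split; try assumption; apply hP; assumption].
    lra. }
  change (scal 1 (Riemann_sum h P)) with (1 * Riemann_sum h P) in hb.
  rewrite Rmult_1_l, hsum, Rabs_minus_sym in hb. lra.
Qed.

(** * Products with a continuous factor *)

(** A uniform limit of integrable functions is integrable.  The sequence is
    replaced by the filter of the integrable functions uniformly close to [h],
    so that no approximation has to be chosen. *)
Lemma ex_RInt_uniform_approx (h : R -> R) (a b : R)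
  (approx : forall eps : posreal, exists u : R -> R, ex_RInt u a b /\
     forall x, Rmin a b <= x <= Rmax a b -> Rabs (u x - h x) < eps) :
  ex_RInt h a b.
Proof.
  set (inside x := Rmin a b <= x <= Rmax a b).
  set (near (P : {u : R -> R | ex_RInt u a b} -> Prop) := exists eps : posreal,
    forall u, (forall x, inside x -> Rabs (proj1_sig u x - h x) < eps) -> P u).
  assert (near_proper : ProperFilter near).
  { split; [|split].
    - intros P [eps hP]. destruct (approx eps) as [u [hu hux]].
      exists (exist _ u hu). apply hP. exact hux.
    - exists (mkposreal 1 Rlt_0_1). auto.
    - intros P Q [e1 h1] [e2 h2].
      exists (mkposreal _ (Rmin_stable_in_posreal e1 e2)); simpl.
      intros u hu. split; [apply h1|apply h2]; intros x hx;
        (eapply Rlt_le_trans; [apply hu, hx|]);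
        [apply Rmin_l|apply Rmin_r].
    - intros P Q hPQ [eps hP]. exists eps. auto. }
  (* The theorem on uniform limits asks for closeness on the whole line. *)
  set (patch (u : {u : R -> R | ex_RInt u a b}) x :=
    if Rle_dec (Rmin a b) x then
      if Rle_dec x (Rmax a b) then proj1_sig u x else h x
    else h x).
  destruct (filterlim_RInt patch a b near near_proper h
    (fun u => RInt (proj1_sig u) a b)) as [I [_ hI]].
  - intros u. apply is_RInt_ext with (proj1_sig u).
    + intros x hx. unfold patch.
      destruct (Rle_dec (Rmin a b) x); [|lra].
      destruct (Rle_dec x (Rmax a b)); [reflexivity|lra].
    + exact (RInt_correct (proj1_sig u) a b (proj2_sig u)).
  - apply filterlim_locally. intros eps. exists eps. intros u hu x.
    change (Rabs (patch u x - h x) < eps). unfold patch.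
    assert (h0 : Rabs (h x - h x) < eps).
    { rewrite Rminus_diag, Rabs_R0. apply cond_pos. }
    destruct (Rle_dec (Rmin a b) x); [|exact h0].
    destruct (Rle_dec x (Rmax a b)); [|exact h0].
    apply hu. split; assumption.
  - exists I. exact hI.
Qed.

(** The approximation [u] is [c p * g] on each piece of length [s], where [p] is
    the left end of the piece: multiples of [g] are integrable, and freezing [c]
    costs at most its oscillation [eta] times the bound [M] of [g]. *)
Lemma piecewise_scaling (c g : R -> R) (a b s eta M : R) (hs : 0 < s)
  (c_unif : forall x y, a <= x <= b -> a <= y <= b -> Rabs (y - x) <= s ->
     Rabs (c y - c x) < eta)
  (g_int : ex_RInt g a b) (g_bound : forall x, a <= x <= b -> Rabs (g x) <= M)
  (n : nat) :
  forall x, a <= x -> x + INR n * s = b ->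
  exists u : R -> R, ex_RInt u x b /\
    forall y, x <= y <= b -> Rabs (u y - c y * g y) <= eta * M.
Proof.
  assert (bound : forall p y, a <= p <= b -> a <= y <= b -> Rabs (p - y) <= s ->
    Rabs (c p * g y - c y * g y) <= eta * M).
  { intros p y hp hy hpy. rewrite <- Rmult_minus_distr_r, Rabs_mult.
    apply Rmult_le_compat; try apply Rabs_pos.
    - apply Rlt_le, c_unif; assumption.
    - apply g_bound; assumption. }
  induction n as [|n IH]; intros x hax hxb.
  - simpl INR in hxb. exists (fun y => c x * g y). split.
    + replace b with x by lra. apply ex_RInt_point.
    + intros y hy. apply bound; try lra.
      rewrite Rabs_pos_eq; lra.
  - rewrite S_INR in hxb.
    assert (hns : 0 <= INR n * s).
    { apply Rmult_le_pos; [apply pos_INR|lra]. }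
    destruct (IH (x + s)) as [u [hu hub]]; [lra|lra|].
    exists (fun y => if Rle_dec y (x + s) then c x * g y else u y). split.
    + apply ex_RInt_Chasles with (x + s).
      * apply ex_RInt_ext with (fun y => scal (c x) (g y)).
        { rewrite Rmin_left, Rmax_right by lra. intros y hy.
          destruct (Rle_dec y (x + s)); [reflexivity|lra]. }
        apply (ex_RInt_scal (V := R_NormedModule) g).
        apply (ex_RInt_Chasles_1 (V := R_CompleteNormedModule) g) with b; [lra|].
        apply (ex_RInt_Chasles_2 (V := R_CompleteNormedModule) g) with a; [lra|assumption].
      * apply ex_RInt_ext with u; [|assumption].
        rewrite Rmin_left, Rmax_right by lra. intros y hy.
        destruct (Rle_dec y (x + s)); [lra|reflexivity].
    + intros y hy. destruct (Rle_dec y (x + s)).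
      * apply bound; try lra. rewrite Rabs_minus_sym, Rabs_pos_eq; lra.
      * apply hub. lra.
Qed.

(** A continuous [c] is uniformly continuous on [[a,b]] and an integrable [g] is
    bounded there, so the piecewise multiples of [g] approximate [c * g] as well
    as desired. *)
Lemma ex_RInt_mult_continuous (c g : R -> R) (a b : R) (hab : a < b)
  (c_cont : forall x, a <= x <= b -> continuity_pt c x)
  (g_int : ex_RInt g a b) :
  ex_RInt (fun x => c x * g x) a b.
Proof.
  destruct (ex_RInt_ub g a b g_int) as [M hM].
  rewrite Rmin_left, Rmax_right in hM by lra.
  assert (hM0 : 0 <= M).
  { apply Rle_trans with (Rabs (g a)); [apply Rabs_pos|apply hM; lra]. }
  apply ex_RInt_uniform_approx. intros eps.
  rewrite Rmin_left, Rmax_right by lra.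
  (* The bound [M] may be zero, hence the [+ 1]. *)
  assert (heta : 0 < eps / (M + 1)).
  { apply Rdiv_lt_0_compat; [apply cond_pos|lra]. }
  destruct (unifcont_1d c a b) with (mkposreal _ heta) as [delta hdelta].
  { intros x hx. apply continuity_pt_filterlim, c_cont, hx. }
  destruct (subdivide_lt (b - a) delta) as [n [s [hs hns]]];
    [lra|apply cond_pos|].
  destruct (piecewise_scaling c g a b s (eps / (M + 1)) M) with (n := n) (x := a)
    as [u [hu hub]]; try lra; try assumption.
  { intros x y hx hy hxy.
    assert (hxy' : Rabs (y - x) < delta) by lra.
    apply Rnot_le_lt. intros hge. apply (hdelta x y hx hy hxy').
    intros hlt. exact (Rlt_not_le _ _ hlt hge). }
  exists u. split; [assumption|]. intros x hx.
  apply Rle_lt_trans with (eps / (M + 1) * M); [apply hub; assumption|].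
  apply Rlt_le_trans with (eps / (M + 1) * (M + 1)).
  - apply Rmult_lt_compat_l; lra.
  - right. field. lra.
Qed.

(** * Derivatives relative to a closed interval *)

(** The analogue of [derivable_pt_lim] that only looks at [F] on [[a,b]], hence
    one-sided at the endpoints. *)
Definition derivable_lim_within (a b : R) (F : R -> R) (t d : R) : Prop :=
  forall eps, 0 < eps -> exists delta, 0 < delta /\
    forall h, h <> 0 -> Rabs h < delta -> a <= t + h <= b ->
      Rabs ((F (t + h) - F t) / h - d) < eps.

Definition clamp (a b x : R) : R := Rmax a (Rmin b x).

Lemma clamp_in (a b x : R) (hab : a <= b) : a <= clamp a b x <= b.
Proof.
  unfold clamp. split; [apply Rmax_l|].
  apply Rmax_lub; [assumption|apply Rmin_l].
Qed.

Lemma clamp_id (a b x : R) (hx : a <= x <= b) : clamp a b x = x.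
Proof. unfold clamp. rewrite Rmin_right, Rmax_right; lra. Qed.

Lemma clamp_contract (a b x t : R) (ht : a <= t <= b) :
  Rabs (clamp a b x - t) <= Rabs (x - t).
Proof.
  unfold clamp, Rmax, Rmin.
  destruct (Rle_dec b x); destruct (Rle_dec a _);
    unfold Rabs; repeat destruct Rcase_abs; lra.
Qed.

(** Clamping does not increase the distance to a point [t] of [[a,b]], so the
    relative derivative controls the extended function on both sides of [t]; this
    gives continuity at the endpoints too. *)
Lemma continuity_pt_clamp (a b : R) (F : R -> R) (t d : R) (ht : a <= t <= b)
  (F_diff : derivable_lim_within a b F t d) :
  continuity_pt (fun x => F (clamp a b x)) t.
Proof.
  (* Near [t] the difference quotient is bounded by [Rabs d + 1]. *)
  destruct (F_diff 1 Rlt_0_1) as [delta [hdelta hF]].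
  assert (hK : 0 < Rabs d + 1) by (generalize (Rabs_pos d); lra).
  intros eps heps. exists (Rmin delta (eps / (Rabs d + 1))). split.
  { apply Rmin_glb_lt; [assumption|]. apply Rdiv_lt_0_compat; lra. }
  intros x [_ hx]. simpl in hx |- *. unfold Rdist in hx |- *.
  rewrite (clamp_id a b t ht).
  set (h := clamp a b x - t).
  assert (hh : Rabs h <= Rabs (x - t)) by (apply clamp_contract, ht).
  assert (hin : a <= t + h <= b).
  { replace (t + h) with (clamp a b x) by (unfold h; ring).
    apply clamp_in; lra. }
  replace (clamp a b x) with (t + h) by (unfold h; ring).
  destruct (Req_dec h 0) as [h0|h0].
  { rewrite h0, Rplus_0_r, Rminus_diag, Rabs_R0. assumption. }
  pose proof (Rmin_l delta (eps / (Rabs d + 1))) as hl.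
  pose proof (Rmin_r delta (eps / (Rabs d + 1))) as hr.
  specialize (hF h h0 ltac:(lra) hin).
  set (q := (F (t + h) - F t) / h) in hF.
  assert (hq : Rabs q <= Rabs d + 1).
  { replace q with ((q - d) + d) by ring.
    eapply Rle_trans; [apply Rabs_triang|]. lra. }
  replace (F (t + h) - F t) with (q * h) by (unfold q; field; exact h0).
  rewrite Rabs_mult.
  apply Rle_lt_trans with ((Rabs d + 1) * Rabs h).
  { apply Rmult_le_compat_r; [apply Rabs_pos|assumption]. }
  replace eps with ((Rabs d + 1) * (eps / (Rabs d + 1))) by (field; lra).
  apply Rmult_lt_compat_l; lra.
Qed.

Lemma is_derive_clamp (a b : R) (F : R -> R) (t d : R) (ht : a < t < b)
  (F_diff : derivable_lim_within a b F t d) :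
  is_derive (fun x => F (clamp a b x)) t d.
Proof.
  apply is_derive_Reals. intros eps heps.
  destruct (F_diff eps heps) as [delta [hdelta hF]].
  assert (hr : 0 < Rmin delta (Rmin (t - a) (b - t))).
  { repeat apply Rmin_glb_lt; lra. }
  exists (mkposreal _ hr). intros h h0 hh. simpl in hh.
  pose proof (Rmin_l delta (Rmin (t - a) (b - t))).
  pose proof (Rmin_r delta (Rmin (t - a) (b - t))).
  pose proof (Rmin_l (t - a) (b - t)).
  pose proof (Rmin_r (t - a) (b - t)).
  assert (hin : a <= t + h <= b).
  { assert (h1 : Rabs h < t - a) by lra. assert (h2 : Rabs h < b - t) by lra.
    apply Rabs_def2 in h1. apply Rabs_def2 in h2. lra. }
  rewrite !clamp_id by lra. apply hF; [assumption|lra|assumption].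
Qed.

(** * The trapezoid identity *)

(** Integration by parts for [(x - m) F x] with [m] the midpoint: since
    [b - m = m - a = (b - a) / 2], both endpoint values enter with the same
    weight. *)
Lemma RInt_centered_derivative (a b : R) (hab : a < b) (F g : R -> R)
  (F_diff : forall t, a <= t <= b -> derivable_lim_within a b F t (g t))
  (g_int : ex_RInt g a b) :
  ex_RInt F a b /\
  ex_RInt (fun x => (x - (a + b) / 2) * g x) a b /\
  RInt (fun x => (x - (a + b) / 2) * g x) a b =
    (b - a) / 2 * (F a + F b) - RInt F a b.
Proof.
  set (Fc x := F (clamp a b x)).
  assert (Fc_cont : forall x, a <= x <= b -> continuity_pt Fc x).
  { intros x hx. exact (continuity_pt_clamp a b F x _ hx (F_diff x hx)). }
  assert (Fc_id : forall x, a <= x <= b -> Fc x = F x).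
  { intros x hx. unfold Fc. rewrite clamp_id; [reflexivity|assumption]. }
  assert (Fc_int : ex_RInt Fc a b).
  { apply (ex_RInt_continuous (V := R_CompleteNormedModule)).
    rewrite Rmin_left, Rmax_right by lra.
    intros x hx. apply continuity_pt_filterlim, Fc_cont, hx. }
  assert (xg_int : ex_RInt (fun x => (x - (a + b) / 2) * g x) a b).
  { apply ex_RInt_mult_continuous; [assumption| |assumption].
    intros x _. apply derivable_continuous_pt. reg. }
  split; [|split; [assumption|]].
  { apply ex_RInt_ext with Fc; [|assumption].
    rewrite Rmin_left, Rmax_right by lra. intros x hx. apply Fc_id; lra. }
  assert (ftc : RInt (fun x => Fc x + (x - (a + b) / 2) * g x) a b =
    (b - (a + b) / 2) * Fc b - (a - (a + b) / 2) * Fc a).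
  { apply (RInt_of_derivative (fun x => (x - (a + b) / 2) * Fc x)).
    - assumption.
    - intros x hx. apply continuity_pt_mult; [|apply Fc_cont, hx].
      apply derivable_continuous_pt. reg.
    - intros x hx.
      assert (dF : is_derive Fc x (g x)).
      { apply is_derive_clamp; [assumption|]. apply F_diff; lra. }
      auto_derive; [exists (g x); exact dF|].
      change (fun x0 : R => Fc x0) with Fc.
      rewrite (is_derive_unique _ _ _ dF). ring.
    - apply (ex_RInt_plus (V := R_NormedModule) Fc); assumption. }
  rewrite (RInt_plus (V := R_CompleteNormedModule) Fc) in ftc by assumption.
  rewrite !Fc_id in ftc by lra.
  rewrite (RInt_ext F Fc).
  - unfold plus in ftc; simpl in ftc. lra.
  - rewrite Rmin_left, Rmax_right by lra. intros x hx. symmetry. apply Fc_id; lra.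
Qed.

(** * Multiplicative derivatives *)

(** The logarithm of [(f (t + h) / f t) ^ (1 / h)] is the difference quotient of
    [ln f], and [ln] is continuous at the positive limit. *)
Lemma is_mul_derive_ln (a b : R) (f : R -> R) (t l : R)
  (f_pos : positive_on a b f) (ht : a <= t <= b)
  (hl : is_mul_derive a b f t l) :
  derivable_lim_within a b (fun x => ln (f x)) t (ln l).
Proof.
  destruct hl as [l_pos hl].
  assert (ln_cont : filterlim ln (locally l) (locally (ln l))).
  { apply continuity_pt_filterlim, derivable_continuous_pt.
    exists (/ l). apply derivable_pt_lim_ln, l_pos. }
  pose proof (filterlim_comp _ _ _ _ _ _ _ _ hl ln_cont) as lim.
  intros eps heps.
  destruct (proj1 (filterlim_locally _ _) lim (mkposreal eps heps))
    as [delta hdelta].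
  exists delta. split; [apply cond_pos|]. intros h h0 hh hin.
  assert (hb : ball 0 delta h).
  { change (Rabs (h - 0) < delta). rewrite Rminus_0_r. exact hh. }
  specialize (hdelta h hb h0 hin).
  change (Rabs (ln (Rpower (f (t + h) / f t) (1 / h)) - ln l) < eps) in hdelta.
  unfold Rpower in hdelta. rewrite ln_exp, ln_div in hdelta by (apply f_pos; lra).
  replace ((ln (f (t + h)) - ln (f t)) / h)
    with (1 / h * (ln (f (t + h)) - ln (f t))) by (field; exact h0).
  exact hdelta.
Qed.

(** At an endpoint only one sign of the increment is admissible; a small
    step towards the farther endpoint stays inside. *)
Lemma increments_proper (a b t : R) (hab : a < b) (ht : a <= t <= b) :
  ProperFilter' (within (fun h => a <= t + h <= b) (locally' 0)).
Proof.
  constructor.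
  - intros [delta hdelta].
    assert (step : forall h, Rabs h < delta -> h <> 0 -> a <= t + h <= b -> False).
    { intros h hh h0 hin. apply (hdelta h); try assumption.
      change (Rabs (h - 0) < delta). rewrite Rminus_0_r. exact hh. }
    pose proof (cond_pos delta) as hd.
    set (r := Rmin (delta / 2) ((b - a) / 2)).
    assert (r_pos : 0 < r) by (apply Rmin_glb_lt; lra).
    pose proof (Rmin_l (delta / 2) ((b - a) / 2)) as r1. fold r in r1.
    pose proof (Rmin_r (delta / 2) ((b - a) / 2)) as r2. fold r in r2.
    destruct (Rle_dec t ((a + b) / 2)).
    + apply (step r); try lra. rewrite Rabs_pos_eq; lra.
    + apply (step (- r)); try lra. rewrite Rabs_Ropp, Rabs_pos_eq; lra.
  - repeat apply within_filter. apply locally_filter.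
Qed.

(** The description operator returns the limit because limits along a proper
    filter are unique. *)
Lemma mul_derive_correct (a b : R) (f : R -> R) (t : R) (hab : a < b)
  (ht : a <= t <= b) (f_diff : ex_mul_derive a b f t) :
  is_mul_derive a b f t (mul_derive a b f t).
Proof.
  destruct f_diff as [l hl].
  apply (iota_correct (V := R_CompleteNormedModule) (is_mul_derive a b f t)).
  exists l. split; [assumption|]. intros l' hl'.
  eapply (filterlim_locally_unique (V := R_NormedModule) (FF := increments_proper a b t hab ht));
    [exact (proj2 hl)|exact (proj2 hl')].
Qed.

Theorem lemma3p2 (a b : R) (hab : a < b) (f : R -> R)
  (f_pos : positive_on a b f)
  (f_diff : mul_differentiable_on a b f)
  (f_int : mul_integrable (mul_derive a b f) a b) :
  mul_integrable f a b /\
  mul_integrable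
    (fun t => Rpower (mul_derive a b f ((1 - t) * a + t * b)) (2 * t - 1)) 0 1 /\
  geom_mean (f a) (f b) * Rpower (mul_integral f a b) (1 / (a - b)) =
  Rpower
    (mul_integral
       (fun t => Rpower (mul_derive a b f ((1 - t) * a + t * b)) (2 * t - 1)) 0 1)
    ((b - a) / 2).
Proof.
  set (g x := ln (mul_derive a b f x)).
  destruct (RInt_centered_derivative a b hab (fun x => ln (f x)) g)
    as [F_int [xg_int trapezoid]].
  { intros t ht. apply is_mul_derive_ln; try assumption.
    apply mul_derive_correct; [assumption..|]. apply f_diff, ht. }
  { exact (proj2 f_int). }
  set (k x := (x - (a + b) / 2) * g x) in *.
  (* With [x = (b - a) t + a], one has [2 t - 1 = 2 (x - m) / (b - a)]; the
     other factor [1 / (b - a)] cancels the Jacobian of the substitution. *)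
  set (c := 2 / ((b - a) * (b - a))).
  set (integrand t := scal c (scal (b - a) (k ((b - a) * t + a)))).
  assert (weight : forall t, integrand t =
    ln (Rpower (mul_derive a b f ((1 - t) * a + t * b)) (2 * t - 1))).
  { intros t. unfold Rpower. rewrite ln_exp.
    change (c * ((b - a) * k ((b - a) * t + a)) =
            (2 * t - 1) * g ((1 - t) * a + t * b)).
    unfold k, c.
    replace ((1 - t) * a + t * b) with ((b - a) * t + a) by ring.
    field. lra. }
  assert (k_int : ex_RInt k ((b - a) * 0 + a) ((b - a) * 1 + a)).
  { replace ((b - a) * 0 + a) with a by ring.
    replace ((b - a) * 1 + a) with b by ring. exact xg_int. }
  pose proof (ex_RInt_comp_lin (V := R_NormedModule) k _ _ _ _ k_int) as kl_int.
  assert (value : RInt (fun t => ln (Rpower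
      (mul_derive a b f ((1 - t) * a + t * b)) (2 * t - 1))) 0 1 = c * RInt k a b).
  { rewrite <- (RInt_ext integrand) by (intros t _; apply weight).
    unfold integrand.
    rewrite (RInt_scal (V := R_CompleteNormedModule)) by exact kl_int.
    rewrite (RInt_comp_lin (V := R_CompleteNormedModule)) by exact k_int.
    replace ((b - a) * 0 + a) with a by ring.
    replace ((b - a) * 1 + a) with b by ring. reflexivity. }
  split; [split; assumption|split; [split|]].
  - intros t _. apply exp_pos.
  - apply ex_RInt_ext with integrand; [intros t _; apply weight|].
    apply (ex_RInt_scal (V := R_NormedModule)), kl_int.
  - unfold mul_integral.
    rewrite value, trapezoid.
    assert (fa : 0 < f a) by (apply f_pos; lra).
    assert (fb : 0 < f b) by (apply f_pos; lra).
    unfold geom_mean.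
    rewrite <- Rpower_sqrt by (apply Rmult_lt_0_compat; assumption).
    unfold Rpower. rewrite !ln_exp, ln_mult by assumption.
    rewrite <- exp_plus. f_equal. unfold c. field. lra.
Qed.
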